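(* Let $G$ be a graph and let $S \subseteq V_G$ be a cycle cover of $G$. Let $G \cup W(S)$ be the graph obtained from $G$ by adding one whisker at each vertex in $S$, and let $e_1,\dots,e_m$ be the edges of $G \cup W(S)$. Let $(k_1, \dots, k_m)$ be a tuple of nonnegative integers satisfying the following condition: for every vertex $x \in S$, if $e_i$ is the whisker added at $x$ and $e_j$ is any edge of $G$ incident to $x$, then $k_i \ge k_j$. Then the graph $(G \cup W(S))(k_1, \dots, k_m)$ is vertex decomposable.
   Context: All graphs are finite, simple and undirected; $V_G$ and $E_G$ denote the vertex set and edge set of $G$. A subset $S \subseteq V_G$ is a cycle cover of $G$ if the induced subgraph $G \setminus S$ on $V_G\setminus S$ has no cycle. Adding a whisker at a vertex $x$ means adding a new vertex $y$ and the new edge $\{x,y\}$. Duplicating the edges: let $\Gamma$ be a graph with vertices $x_1,\dots,x_n$ and edges $e_1,\dots,e_m$. For an edge $e=\{x_i,x_j\}$ and an integer $r \ge 0$, set $V(e(r)) = \{x_{t,p} \mid t \in \{i,j\},\ 1\le p\le r\}$ and $E(e(r)) = \{\{x_{i,p},x_{j,q}\} \mid p,q\ge 1,\ p+q\le r+1\}$. For $(k_1,\dots,k_m)\in \mathbb Z_{\ge 0}^m$, $\Gamma(k_1,\dots,k_m)$ is the graph with vertex set $\bigcup_{i=1}^m V(e_i(k_i))$ and edge set $\bigcup_{i=1}^m E(e_i(k_i))$. For a vertex $x$ of a graph $\Gamma$, $N_\Gamma[x] = \{x\}\cup\{y \mid \{x,y\}\in E_\Gamma\}$; for $U \subseteq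 V_\Gamma$, $\Gamma\setminus U$ is the induced subgraph on $V_\Gamma \setminus U$. A graph $\Gamma$ is vertex decomposable if either $\Gamma$ consists of isolated vertices (no edges), or there is a vertex $x$ such that (1) $x$ is a shedding vertex, i.e. no independent set in $\Gamma\setminus N_\Gamma[x]$ is a maximal independent set in $\Gamma\setminus x$, and (2) both $\Gamma\setminus x$ and $\Gamma\setminus N_\Gamma[x]$ are vertex decomposable. *)

(* Defs.v *)
From mathcomp Require Import all_boot.

Set Implicit Arguments.
Unset Strict Implicit.
Unset Printing Implicit Defensive.

Record sgraph := SGraph {
  svertex :> finType;
  sedge : rel svertex;
  sedge_sym : symmetric sedge;
  sedge_irr : irreflexive sedge
}.

Arguments sedge {s} x y.
Notation "x -- y" := (sedge x y) (at level 30).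

Definition edges (G : sgraph) : {set {set G}} :=
  [set [set p.1; p.2] | p : G * G & p.1 -- p.2].

(* In what follows, [A : {set G}] stands for the subgraph of [G] induced on
   [A]; thus [G \ U] is [~: U], and [(G[A]) \ U] is [A :\: U]. *)

(* [ucycle] also accepts closed walks with at most two vertices, hence the
   size condition. *)
Definition acyclic_on (G : sgraph) (A : {set G}) : Prop :=
  forall c : seq G, {subset c <= A} -> 2 < size c -> ~ ucycle sedge c.

Definition cycle_cover (G : sgraph) (S : {set G}) : Prop := acyclic_on (~: S).

Definition closed_nbh (G : sgraph) (x : G) : {set G} :=
  x |: [set y | x -- y].

Definition independent_in (G : sgraph) (A I : {set G}) : bool :=
  (I \subset A) && [forall x in I, forall y in I, ~~ (x -- y)].

Definition max_independent_in (G : sgraph) (A I : {set G}) : bool :=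
  maxset (independent_in A) I.

Definition shedding_on (G : sgraph) (A : {set G}) (x : G) : Prop :=
  forall I : {set G}, independent_in (A :\: closed_nbh x) I ->
    ~~ max_independent_in (A :\ x) I.

Inductive vertex_decomposable_on (G : sgraph) : {set G} -> Prop :=
| VD_edgeless (A : {set G}) :
    {in A &, forall x y, ~~ (x -- y)} -> vertex_decomposable_on A
| VD_shedding (A : {set G}) (x : G) :
    x \in A -> shedding_on A x ->
    vertex_decomposable_on (A :\ x) ->
    vertex_decomposable_on (A :\: closed_nbh x) ->
    vertex_decomposable_on A.

Definition vertex_decomposable (G : sgraph) : Prop :=
  vertex_decomposable_on [set: G].

Section Whiskers.
Variables (G : sgraph) (S : {set G}).

(* [inr x] is the new endpoint of the whisker added at [x \in S]. *)
Definition whisker_vertex : finType := (G + {x : G | x \in S})%type.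

Definition whisker_rel (u v : whisker_vertex) : bool :=
  match u, v with
  | inl x, inl y => x -- y
  | inl x, inr y => x == val y
  | inr x, inl y => val x == y
  | inr _, inr _ => false
  end.

Lemma whisker_sym : symmetric whisker_rel.
Proof. by case=> [x|x] [y|y] //=; [apply: sedge_sym | apply: eq_sym..]. Qed.

Lemma whisker_irr : irreflexive whisker_rel.
Proof. by case=> [x|x] //=; apply: sedge_irr. Qed.

Definition add_whiskers : sgraph := SGraph whisker_sym whisker_irr.

Definition old_vertex (x : G) : add_whiskers := inl x.

Definition new_vertex (x : {x : G | x \in S}) : add_whiskers := inr x.

End Whiskers.

Arguments old_vertex {G S} x.
Arguments new_vertex {G S} x.

Section Duplication.
(* The tuple [(k_1, ..., k_m)] is indexed by the edges themselves; only the
   values of [k] on [edges G] are ever used. *)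
Variables (G : sgraph) (k : {set G} -> nat).

Definition dup_bound : nat := \max_(e in edges G) k e.

(* [(t, p)] encodes [x_{t,p}]; the index [p] starts at 1, and [dup_bound] only
   serves to make the ambient type finite. *)
Definition is_dup_vertex (u : G * 'I_dup_bound.+1) : bool :=
  [exists e in edges G, (u.1 \in e) && (1 <= u.2 <= k e)].

Definition dup_vertex : finType :=
  {u : G * 'I_dup_bound.+1 | is_dup_vertex u}.

Definition dup_rel (u v : dup_vertex) : bool :=
  let: (i, p) := val u in
  let: (j, q) := val v in
  (i -- j) && (p + q <= k [set i; j] + 1).

Lemma dup_sym : symmetric dup_rel.
Proof.
move=> [[i p] ?] [[j q] ?]; rewrite /dup_rel /=.
by rewrite sedge_sym addnC setUC.
Qed.

Lemma dup_irr : irreflexive dup_rel.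
Proof. by move=> [[i p] ?]; rewrite /dup_rel /= sedge_irr. Qed.

Definition duplicate : sgraph := SGraph dup_sym dup_irr.

End Duplication.

(* Main.v *)
Require Import Defs.
From mathcomp Require Import all_boot zify.

Set Implicit Arguments.
Unset Strict Implicit.
Unset Printing Implicit Defensive.

(** The vertices [x_{t,p}] of the duplicated graph form columns, one for each
vertex [t], and neighbourhoods shrink as [p] grows.  Hence deleting the lowest
remaining vertex of a column, or its closed neighbourhood, leaves an induced
subgraph of the same shape: column [t] is cut at some height [c t].  An edge
[ij] survives exactly when [c i + c j < k_ij]; if [j] has [i] as its only
surviving neighbour, then the vertex of column [j] at height [k_ij - c i] is a
leaf attached to the lowest vertex of column [i], which is therefore shedding.
As long as the whisker column at [x \in S] is uncut, a surviving edge at [x]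
makes the whisker survive, by the assumption on [k]; and the whisker column gets
cut only when the closed neighbourhood of the lowest vertex of column [x] is
removed, which kills all edges at [x].  Once no edge at [S] survives, a leaf is
found in the forest [G \ S]. *)

(** Without a leaf, the first vertex [u] of a path has a neighbour [l] other than its successor [v].
    By acyclicity [l] is not on the path, so paths grow beyond [#|T|]. *)
Lemma acyclic_leaf (T : finType) (e : rel T) (x y : T) :
    symmetric e -> irreflexive e ->
    (forall c : seq T, 2 < size c -> ~ ucycle e c) -> e x y ->
  exists i j, e i j /\ forall l, e j l -> l = i.
Proof.
move=> e_sym e_irr acyc exy.
case: (boolP [exists i, exists j, e i j && [forall l, e j l ==> (l == i)]]).
  case/existsP=> i /existsP[j /andP[eij /forallP leaf]].
  by exists i, j; split=> // l ejl; apply/eqP; have := leaf l; rewrite ejl.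
move=> noleaf.
have long n : exists u v p, [/\ uniq [:: u, v & p], path e u (v :: p)
    & size p = n].
  elim: n => [|n [u [v [p [Up ep sp]]]]].
    exists x, y, [::]; split=> //=; rewrite ?exy // andbT inE.
    by apply: contraTneq exy => ->; rewrite e_irr.
  have /existsP[l /andP[eul lv]] : [exists l, e u l && (l != v)].
    apply: contraR noleaf => /existsPn noext.
    apply/existsP; exists v; apply/existsP; exists u.
    move: ep => /= /andP[euv _]; rewrite e_sym euv /=.
    apply/forallP=> l; apply/implyP=> eul.
    by have := noext l; rewrite eul negbK.
  have lu : l != u by apply: contraTneq eul => ->; rewrite e_irr.
  have [lp|lp] := boolP (l \in p); last first.
    exists l, u, (v :: p); split; last by rewrite /= sp.
      by rewrite cons_uniq Up andbT !inE (negPf lu) (negPf lv).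
    by rewrite /= e_sym eul.
  case/splitPr: lp Up ep {sp} => p1 p2 Up ep.
  case: (acyc [:: u, v & rcons p1 l]); first by rewrite /= size_rcons.
  move: Up ep; rewrite -cat_rcons -!cat_cons cat_uniq cat_path.
  move=> /andP[Up _] /andP[ep _]; apply/andP; split=> //.
  by rewrite /cycle rcons_path ep /= last_rcons e_sym.
have [u [v [p [Up _ sp]]]] := long #|T|.
have := max_card [in [:: u, v & p]]; rewrite (card_uniqP Up) /= sp.
by rewrite ltnNge leqnSn.
Qed.

(** A set avoiding [closed_nbh x] contains neither [y] nor a neighbour of [y], so adding [y] keeps
    it independent: it was not maximal. *)
Lemma dominating_shedding (G : sgraph) (A : {set G}) (x y : G) :
    y \in A -> x -- y -> A :&: closed_nbh y \subset closed_nbh x ->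
  shedding_on A x.
Proof.
move=> yA xy dom I /andP[/subsetP sI /forall_inP indI].
have yx : y != x by apply: contraTneq xy => ->; rewrite sedge_irr.
have ynI z : z \in I -> ~~ (y -- z).
  move=> zI; have := sI z zI; rewrite inE => /andP[zx zA].
  apply: contra zx => yz; apply: (subsetP dom).
  by rewrite !inE zA yz orbT.
apply/negP=> /maxsetP[_ maxI].
have yI : y \in I.
  rewrite -(maxI (y |: I)) ?subsetUr ?setU11 //; apply/andP; split.
    apply/subsetP=> z; rewrite in_setU1 => /predU1P[->|zI].
      by rewrite !inE yx.
    move: (sI z zI); rewrite !inE => /andP[+ ->].
    by rewrite andbT; apply: contra => ->.
  apply/forall_inP=> u; rewrite in_setU1 => uI.
  apply/forall_inP=> v; rewrite in_setU1 => vI.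
  case/predU1P: uI vI => [->|uI] /predU1P[->|vI].
  - by rewrite sedge_irr.
  - exact: ynI.
  - by rewrite sedge_sym; apply: ynI.
  - exact: (forall_inP (indI u uI)).
by have := sI y yI; rewrite !inE xy orbT.
Qed.

Section CutColumns.
Variables (H : sgraph) (k : {set H} -> nat).
Implicit Types (c : H -> nat) (i j l : H).

Definition col (u : duplicate k) : H := (val u).1.

Definition row (u : duplicate k) : nat := (val u).2.

Definition above c : {set duplicate k} :=
  [set u : duplicate k | c (col u) < row u].

Definition live c i j : bool := (i -- j) && (c i + c j < k [set i; j]).

Definition cut_vertex c i : H -> nat := fun l => if l == i then (c i).+1 else c l.

(** For [q > 0], row [q] of an adjacent column [l] is joined to row [(c i).+1] of column [i] exactly
    when [q <= k [set i; l] - c i]. *)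
Definition cut_nbh c i : H -> nat := fun l =>
  if l == i then (c i).+1
  else if i -- l then maxn (c l) (k [set i; l] - c i) else c l.

Lemma live_sym c : symmetric (live c).
Proof. by move=> i j; rewrite /live sedge_sym addnC setUC. Qed.

Lemma live_irr c : irreflexive (live c).
Proof. by move=> i; rewrite /live sedge_irr. Qed.

Lemma live_anti c c' i j : (forall l, c l <= c' l) -> live c' i j -> live c i j.
Proof.
move=> cc' /andP[ij lt_c']; rewrite /live ij.
exact: leq_ltn_trans (leq_add (cc' i) (cc' j)) lt_c'.
Qed.

Lemma cut_vertex_ge c i l : c l <= cut_vertex c i l.
Proof. by rewrite /cut_vertex; case: eqP => [->|]. Qed.

Lemma cut_nbh_ge c i l : c l <= cut_nbh c i l.
Proof. by rewrite /cut_nbh; case: eqP => [->|] //; case: ifP; rewrite ?leq_maxl. Qed.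

Lemma cut_nbh_dead c i l : ~~ live (cut_nbh c i) i l.
Proof.
rewrite /live /cut_nbh eqxx; case: (eqVneq l i) => [->|_].
  by rewrite sedge_irr.
by case: (i -- l) => //=; lia.
Qed.

Lemma dup_vertex_exists i j p : i -- j -> 0 < p <= k [set i; j] ->
  exists u : duplicate k, col u = i /\ row u = p.
Proof.
move=> ij /andP[p0 pk].
have eE : [set i; j] \in edges H by apply/imsetP; exists (i, j); rewrite ?inE.
have pb : p < (dup_bound k).+1.
  by rewrite ltnS (leq_trans pk) // /dup_bound (bigD1 _ eE) leq_maxl.
have iP : is_dup_vertex (i, Ordinal pb).
  by apply/existsP; exists [set i; j]; rewrite eE !inE eqxx /= p0.
by exists (Sub _ iP).
Qed.

Lemma dup_edgeE (u v : duplicate k) : (u -- v) =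
  (col u -- col v)
    && (row u + row v <= k [set col u; col v] + 1).
Proof. by case: u v => [[i p] ?] [[j q] ?]. Qed.

Lemma dup_eqE (u v : duplicate k) :
  (u == v) = (col u == col v) && (row u == row v).
Proof. by rewrite -val_eqE. Qed.

Lemma above_edgeless c : (forall i j, ~~ live c i j) ->
  {in above c &, forall u v, ~~ (u -- v)}.
Proof.
move=> dead u v; rewrite !inE dup_edgeE => cu cv.
by have := dead (col u) (col v); rewrite /live; case: (_ -- _) => //=; lia.
Qed.

Lemma above_cut_vertex c (u : duplicate k) : row u = (c (col u)).+1 ->
  above c :\ u = above (cut_vertex c (col u)).
Proof.
move=> low; apply/setP=> v; rewrite !inE dup_eqE low /cut_vertex.
by case: eqP => [->|] //=; lia.
Qed.

Lemma above_cut_nbh c (u : duplicate k) : row u = (c (col u)).+1 ->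
  above c :\: closed_nbh u = above (cut_nbh c (col u)).
Proof.
move=> low; apply/setP=> v; rewrite !inE dup_eqE dup_edgeE low /cut_nbh.
case: eqP => [->|_] /=; first by rewrite sedge_irr /=; lia.
by case: (_ -- _) => //=; lia.
Qed.

(** [P] is an invariant of the cutting process; the induction is on the number of remaining
    vertices. *)
Lemma vertex_decomposable_above (P : (H -> nat) -> Prop) :
    (forall c, P c -> (forall i j, ~~ live c i j) \/
       exists i j, [/\ live c i j, forall l, live c j l -> l = i,
                       P (cut_vertex c i) & P (cut_nbh c i)]) ->
  forall c, P c -> vertex_decomposable_on (above c).
Proof.
move=> step c; have [n] := ubnP #|above c|.
elim: n c => // n IHn c le_n Pc.
have [dead|[i [j [lij leaf Pv Pn]]]] := step c Pc.
  exact/VD_edgeless/above_edgeless.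
have /andP[ij ltk] := lij.
have [u [u1 u2]] : exists u, col u = i /\ row u = (c i).+1.
  by apply: dup_vertex_exists ij _; lia.
(* This is the highest row of column [j] still adjacent to [u]; liveness of [ij] puts it above the
   cut. *)
have [v [v1 v2]] : exists v, col v = j /\ row v = k [set i; j] - c i.
  by apply: (@dup_vertex_exists j i); rewrite 1?sedge_sym // (setUC [set j]); lia.
have uA : u \in above c by rewrite inE u1 u2.
have low : row u = (c (col u)).+1 by rewrite u1 u2.
have smaller (B : {set duplicate k}) : B \subset above c :\ u -> #|B| < n.
  move=> /subset_leq_card leB; move: le_n; rewrite (cardsD1 u) uA; lia.
apply: (VD_shedding (x := u)) => //.
- apply: (@dominating_shedding _ _ u v).
  + by rewrite inE v1 v2; lia.
  + by rewrite dup_edgeE u1 v1 u2 v2 ij /=; lia.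
  apply/subsetP=> w; rewrite !inE => /andP[wA /predU1P[->|]].
    by rewrite [u -- v]dup_edgeE u1 v1 u2 v2 ij; apply/orP; right=> /=; lia.
  rewrite (dup_edgeE v) v1 v2 => /andP[jw lew].
  (* An edge between two remaining vertices makes the edge between their columns live. Once [w] is
     in column [i], its row is at most [(c i).+1], hence [w] is [u]. *)
  have w1 : col w = i.
    by apply: leaf; rewrite /live jw /=; lia.
  rewrite dup_eqE w1 u1 eqxx /= u2; move: wA lew; rewrite w1 (setUC [set j]).
  by lia.
- rewrite (above_cut_vertex low) u1; apply: IHn => //.
  by rewrite -[i in cut_vertex _ i]u1 -above_cut_vertex // smaller.
- rewrite (above_cut_nbh low) u1; apply: IHn => //.
  rewrite -[i in cut_nbh _ i]u1 -above_cut_nbh // smaller //.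
  by apply: setDS; rewrite sub1set !inE eqxx.
Qed.

End CutColumns.

Theorem theorem3p7 (G : sgraph) (S : {set G}) (k : {set add_whiskers S} -> nat) :
  cycle_cover S ->
  (forall (x : {x : G | x \in S}) (y : G), val x -- y ->
     k [set old_vertex (val x); old_vertex y]
       <= k [set old_vertex (val x); new_vertex x]) ->
  vertex_decomposable (duplicate k).
Proof.
move=> cover kS.
pose P (c : add_whiskers S -> nat) := forall x : {x : G | x \in S},
  c (new_vertex x) = 0 \/ forall l, ~~ live k c (old_vertex (val x)) l.
(* Cuts are centred at old vertices only, and a dead edge stays dead under further cuts. *)
have Pvertex c z : P c -> P (cut_vertex c (old_vertex z)).
  move=> Pc x; have [cx|dead] := Pc x; first by left.
  right=> l; apply: contra (dead l).
  exact: live_anti (cut_vertex_ge c _).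
have Pnbh c z : P c -> P (cut_nbh k c (old_vertex z)).
  move=> Pc x; have [<-|xz] := eqVneq (val x) z.
    by right=> l; apply: cut_nbh_dead.
  have [cx|dead] := Pc x.
    by left; rewrite /cut_nbh /= eq_sym (negPf xz).
  by right=> l; apply: contra (dead l); apply: live_anti (cut_nbh_ge k c _).
(* Rows start at 1, so cutting at height 0 removes nothing. *)
rewrite /vertex_decomposable; have -> : [set: duplicate k] = above k (fun=> 0).
  apply/setP=> -[u uP]; rewrite !inE /row /=; case/existsP: uP => e.
  by case/and4P=> _ _ ->.
apply: (@vertex_decomposable_above _ k P) => [c Pc|]; last by left.
have [/existsP[x /existsP[z lxz]]|deadS] := boolP [exists x : {x : G | x \in S},
    [exists z, live k c (old_vertex (val x)) z]].
  right; exists (old_vertex (val x)), (new_vertex x); split; auto.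
    have [cx|dead] := Pc x; last by have := dead z; rewrite lxz.
    (* The live edge at [x] is either an edge of [G], whose [k] is at most that of the whisker, or
       the whisker itself. *)
    rewrite /live cx addn0 /= eqxx /=; case: z lxz => [y|y] /andP[/= xy ltk].
      exact: leq_trans (leq_ltn_trans (leq_addr _ _) ltk) (kS x y xy).
    by move: xy ltk => /eqP/val_inj<-; apply: leq_ltn_trans; apply: leq_addr.
  by case=> [y|y] /andP[] //= /eqP->.
have {}deadS (x : G) z : x \in S -> ~~ live k c (old_vertex x) z.
  move=> xS; apply: contra deadS => lxz.
  by apply/existsP; exists (Sub x xS); apply/existsP; exists z.
have deadW x z : ~~ live k c (new_vertex x) z.
  apply/negP=> lxz; case: z lxz => [y|y] lxz; last by case/andP: lxz.
  have /andP[/= /eqP xy _] := lxz.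
  by have := deadS y (new_vertex x); rewrite live_sym lxz -xy => /(_ (valP x)).
pose e : rel G := fun x y => live k c (old_vertex x) (old_vertex y).
have [/existsP[x /existsP[y exy]]|dead] := boolP [exists x, exists y, e x y].
  right; have [||cy cy2 /andP[ecy Ucy]|i [j [eij leaf]]] := acyclic_leaf _ _ _ exy.
  - by move=> u v; apply: live_sym.
  - by move=> u; apply: live_irr.
  (* A cycle of live edges avoids [S], where all edges are dead, so it would be a cycle of [G]
     outside the cover. *)
  - apply: (cover cy) => //; last first.
      by apply/andP; split=> //; apply: sub_cycle ecy => u v /andP[].
    move=> u ucy; rewrite inE; apply/negP=> uS.
    by have := next_cycle ecy ucy; apply/negP; apply: deadS.
  exists (old_vertex i), (old_vertex j); split; auto.
  case=> [l ejl|l]; first by rewrite (leaf l ejl).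
  by rewrite live_sym => ljl; have := deadW l (old_vertex j); rewrite ljl.
left=> -[x|x] [y|y]; try exact: deadW.
  by apply: contra dead => exy; apply/existsP; exists x; apply/existsP; exists y.
by rewrite live_sym; apply: deadW.
Qed.
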